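(* Let $b>a>0$, $q>1$, $q\ge p>0$, and let $m,\ell\in\mathbb{R}$ with $m>0$ and $m\ge2\ell\ge0$. Then $$\left|\frac{2\ell\ln G(a,b)+(m-2\ell)\ln A(a,b)}m-\ln I(a,b)\right|\le\frac{b-a}{4m^2}\left(\frac{q-1}{2q-p-1}\right)^{1-1/q}\left[\frac1{2m(p+1)(p+2)}\right]^{1/q}$$ $$\times\Big[(m-2\ell)^{(2q-p-1)/(q-1)}+(2\ell)^{(2q-p-1)/(q-1)}\Big]^{1-1/q}$$ $$\times\left\{\left[\frac{(2\ell)^{p+2}+(mp+m+2\ell)(m-2\ell)^{p+1}}{a^q}+\frac{(mp+3m-2\ell)(m-2\ell)^{p+1}+(2mp+4m-2\ell)(2\ell)^{p+1}}{b^q}\right]^{1/q}\right.$$ $$\left.+\left[\frac{(2mp+4m-2\ell)(2\ell)^{p+1}+(mp+3m-2\ell)(m-2\ell)^{p+1}}{a^q}+\frac{(2\ell)^{p+2}+(mp+m+2\ell)(m-2\ell)^{p+1}}{b^q}\right]^{1/q}\right\}.$$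
   Context: For positive numbers $a,b$: $A(a,b)=\frac{a+b}2$; $G(a,b)=\sqrt{ab}$; $I(a,b)=\frac1e\left(\frac{b^b}{a^a}\right)^{1/(b-a)}$ if $a\ne b$ and $I(a,a)=a$. *)

(* Defs.v *)
From HB Require Import structures.
From mathcomp Require Import all_boot all_order all_algebra.
From mathcomp Require Import all_classical all_reals all_analysis.
Set Implicit Arguments.
Unset Strict Implicit.
Unset Printing Implicit Defensive.
Import Order.TTheory GRing.Theory Num.Theory.
Local Open Scope ring_scope.

Definition amean (R : realType) (a b : R) : R := (a + b) / 2.

Definition gmean (R : realType) (a b : R) : R := Num.sqrt (a * b).

(* The identric mean. *)
Definition imean (R : realType) (a b : R) : R :=
  if a == b then a
  else 1 / expR 1 * (b `^ b / a `^ a) `^ (1 / (b - a)).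

(* Main.v *)
Require Import Defs.
From HB Require Import structures.
From mathcomp Require Import all_boot all_order all_algebra.
From mathcomp Require Import all_classical all_reals all_analysis.
From mathcomp Require Import ring lra.
Set Implicit Arguments.
Unset Strict Implicit.
Unset Printing Implicit Defensive.
Import Order.TTheory GRing.Theory Num.Theory.
Import numFieldNormedType.Exports.
Local Open Scope classical_set_scope.
Local Open Scope ring_scope.

(** Write [c] for the arithmetic mean of [a] and [b], and [L = 2 * l].
    Since [ln (gmean a b)] is the mean of the values of [ln] at the two
    endpoints, [ln (amean a b)] its value at the midpoint, and
    [ln (imean a b)] its average over [[a, b]], the left-hand side is the
    error of a quadrature rule applied to [ln].  Integrating by parts
    separately on the two halves of [[a, b]], each one parametrized by
    [t] in [[0, m]] running from the midpoint to an endpoint [y], gives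
      [error = (b - a) / (4 * m ^+ 2) * (J a b - J b a)], with
      [J x y] the integral over [[0, m]] of [(t - (m - L)) / z t],
      where [z t = ((m - t) * x + (m + t) * y) / (2 * m)].

    To bound [J x y], write [w = |t - (m - L)|] and split the weight as
    [w = (w `^ ((q - p) / (q - 1))) `^ (1 - 1 / q) * (w `^ p) `^ (1 / q)].
    Hoelder's inequality with exponents [q / (q - 1)] and [q], and then the
    convexity of [z `^ (- q)], leave only integrals of powers of [w] times
    affine functions of [t]; these are the closed forms of the statement.

    No integral has to be formed.  Hoelder's inequality is the weighted
    arithmetic-geometric mean inequality between normalized factors
    ([weighted_AM_GM_normalized]), applied pointwise and then integrated; and
    every function involved has an explicit primitive, so that integrating an
    inequality amounts to comparing the increments of two primitives whose
    derivatives are ordered ([ler_norm_increment]).  [hoelder_ratio_prim]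
    carries this out on each side of the zero [t = m - L] of the weight, and
    [hoelder_half_interval] adds the two sides to bound [J x y]. *)

(** * Comparison of increments and pointwise inequalities *)

(** The integral of [df] is bounded by that of [dg] as soon as
    [`|df| <= dg], expressed with primitives: [g + f] and [g - f] are
    nondecreasing by the mean value theorem.  At [a] only continuity from the
    right is assumed, because [g] will be built from real powers of the distance
    to [a], which are differentiable for positive distances only. *)
Lemma ler_norm_increment (R : realType) (f g df dg : R -> R) (a b : R) :
  a <= b ->
  (forall x, a < x <= b -> is_derive x 1 f (df x)) ->
  (forall x, a < x <= b -> is_derive x 1 g (dg x)) ->
  f x @[x --> a^'+] --> f a -> g x @[x --> a^'+] --> g a ->
  (forall x, a < x <= b -> `|df x| <= dg x) ->
  `|f b - f a| <= g b - g a.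
Proof.
rewrite le_eqVlt => /predU1P[-> *|ab fD gD fa ga dfg].
  by rewrite !subrr normr0.
have mono (h dh : R -> R) : (forall x, a < x <= b -> is_derive x 1 h (dh x)) ->
    h x @[x --> a^'+] --> h a -> (forall x, a < x <= b -> 0 <= dh x) ->
    h a <= h b.
  move=> hD ha dh0.
  have hc x : a < x <= b -> {for x, continuous h}.
    by move=> /hD [dx _]; apply/differentiable_continuous/derivable1_diffP.
  have inab x : x \in `]a, b[ -> a < x <= b.
    by rewrite in_itv /= => /andP[-> /ltW].
  have hcont : {within `[a, b], continuous h}.
    apply/(continuous_within_itvP _ ab); split => //.
      by move=> x /inab; exact: hc.
    by apply: cvg_at_left_filter; apply: hc; rewrite ab lexx.
  have [|x xab hE] := @MVT R h dh a b ab _ hcont.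
    by move=> x /inab; exact: hD.
  by rewrite -subr_ge0 hE mulr_ge0 ?subr_ge0 ?(ltW ab)// dh0 ?inab.
rewrite ler_norml; apply/andP; split.
  have : (g + f) a <= (g + f) b.
    apply: (mono _ (fun x => dg x + df x)).
    - by move=> x /[dup]/fD ? /gD ?; exact: is_deriveD.
    - exact: cvgD.
    - by move=> x /dfg; rewrite ler_norml => /andP[]; lra.
  by rewrite /= !fctE; lra.
have : (g - f) a <= (g - f) b.
  apply: (mono _ (fun x => dg x - df x)).
  - by move=> x /[dup]/fD ? /gD ?; exact: is_deriveB.
  - exact: cvgB.
  - by move=> x /dfg; rewrite ler_norml => /andP[]; lra.
by rewrite !fctE; lra.
Qed.

(** With [x] and [y] functions and [X] and [Y] their integrals, integrating the
    right-hand side turns the last factor into [(1 - s) + s = 1]: this is the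
    pointwise form of Hoelder's inequality with exponents [1 / (1 - s)] and
    [1 / s]. *)
Lemma weighted_AM_GM_normalized (R : realType) (s x y X Y : R) :
  0 < s < 1 -> 0 <= x -> 0 <= y -> 0 < X -> 0 < Y ->
  x `^ (1 - s) * y `^ s <=
  X `^ (1 - s) * Y `^ s * ((1 - s) * (x / X) + s * (y / Y)).
Proof.
move=> /andP[s0 s1] x0 y0 X0 Y0.
have t0 : 0 < 1 - s by rewrite subr_gt0.
have xX0 : 0 <= x / X by rewrite divr_ge0// ltW.
have yY0 : 0 <= y / Y by rewrite divr_ge0// ltW.
rewrite -{1}(divfK (lt0r_neq0 X0) x) -{1}(divfK (lt0r_neq0 Y0) y).
rewrite (powRM _ xX0 (ltW X0)) (powRM _ yY0 (ltW Y0)).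
rewrite mulrACA mulrC ler_wpM2l ?mulr_ge0 ?powR_ge0//.
have := @conjugate_powR R ((x / X) `^ (1 - s)) ((y / Y) `^ s) (1 - s)^-1 s^-1
  (powR_ge0 _ _) (powR_ge0 _ _).
rewrite !invr_gt0 !invrK -!powRrM !mulfV ?gt_eqF// !powRr1//.
by rewrite subrK (mulrC _ s) (mulrC (x / X)) => /(_ t0 s0 erefl).
Qed.

(** [z `^ (- q)] is [expR (- q * ln z)]: concavity of [ln], then convexity of
    [expR]. *)
Lemma convex_powRN (R : realType) (q t x y : R) :
  0 <= q -> 0 <= t <= 1 -> 0 < x -> 0 < y ->
  (t * x + (1 - t) * y) `^ (- q) <= t * x `^ (- q) + (1 - t) * y `^ (- q).
Proof.
move=> q0 /andP[t0 t1] x0 y0.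
have powRNE (z : R) : 0 < z -> z `^ (- q) = expR (- q * ln z).
  by move=> z0; rewrite /powR gt_eqF.
have := @concave_ln R (Itv01 t0 t1) x y x0 y0.
have := convex_expR (Itv01 t0 t1) (- q * ln x) (- q * ln y).
have := @convR_gt0 R x y (Itv01 t0 t1) x0 y0.
rewrite !convRE /= => z0 + lnz.
rewrite !powRNE//; apply: le_trans.
by rewrite ler_expR; nra.
Qed.

(** * Hoelder's inequality on one side of the zero of the weight *)

(** The primitive of [u / (d + e * u)] obtained by integrating by parts, with
    [ln (d + e * u) / e] as primitive of [(d + e * u)^-1]; this form exhibits
    the values and the average of [ln]. *)
Definition ratio_prim (R : realType) (d e u : R) : R :=
  u * ln (d + e * u) / e
  - ((d + e * u) * ln (d + e * u) - (d + e * u)) / e ^+ 2.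

Lemma is_derive_ratio_prim (R : realType) (d e u : R) :
  e != 0 -> 0 < d + e * u -> is_derive u 1 (ratio_prim d e) (u / (d + e * u)).
Proof.
move=> e0 du0.
pose l : R -> R := cst d + e *: id.
have lE x : l x = d + e * x by [].
have lD : is_derive u 1 l e.
  have := is_deriveD (is_derive_cst d u 1) (is_deriveZ e (is_derive_id u 1)).
  by rewrite add0r /GRing.scale /= mulr1.
have lnD : is_derive u 1 (@ln R \o l) (e / (d + e * u)).
  rewrite [e / _]mulrC.
  exact: (@is_derive1_comp R (@ln R) l u _ _ (is_derive1_ln du0) lD).
have -> : ratio_prim d e =
    e^-1 *: (id * (@ln R \o l)) - (e ^- 2) *: (l * (@ln R \o l) - l).
  by apply/funext => x; rewrite /ratio_prim -lE !fctE /GRing.scale /=; ring.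
apply: is_derive_eq.
rewrite /GRing.scale /= !lE.
by field; rewrite e0 gt_eqF.
Qed.

Lemma is_derive_powR_prim (R : realType) (r u : R) :
  0 < r -> 0 < u -> is_derive u 1 (fun x => x `^ r / r) (u `^ (r - 1)).
Proof.
move=> r0 u0.
have -> : (fun x => x `^ r / r) = r^-1 *: (@powR R ^~ r).
  by apply/funext => x; rewrite fctE /GRing.scale /= mulrC.
have D := is_derive1_powR r u0.
apply: is_derive_eq; rewrite /GRing.scale /=.
by rewrite mulKf// gt_eqF.
Qed.

(** The left-hand side is the integral of [u / (d + e * u)] over [[0, k]].  The
    last hypothesis bounds the [q]-th power of [(d + e * u)^-1] by an affine function,
    so the two terms of the last factor are the integrals over [[0, k]] of
    [u `^ ((q - p) / (q - 1))] and of [u `^ p * (A + B * u)].  The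
    normalizations [X] and [Y] are left free: they are the sums of such
    integrals over both sides of the zero of the weight. *)
Lemma hoelder_ratio_prim (R : realType) (p q d e k A B X Y : R) :
  1 < q -> 0 < p <= q -> 0 <= k -> e != 0 -> 0 < d -> 0 < d + e * k ->
  0 < X -> 0 < Y ->
  (forall u, 0 <= u <= k -> (d + e * u) `^ (- q) <= A + B * u) ->
  `|ratio_prim d e k - ratio_prim d e 0| <=
  X `^ (1 - 1 / q) * Y `^ (1 / q) *
  ((1 - 1 / q) * ((k `^ ((2 * q - p - 1) / (q - 1))
                   / ((2 * q - p - 1) / (q - 1))) / X)
   + 1 / q * ((A * (k `^ (p + 1) / (p + 1)) + B * (k `^ (p + 2) / (p + 2))) / Y)).
Proof.
move=> q1 /andP[p0 pq] k0 e0 d0 dk0 X0 Y0 conv.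
set t := (2 * q - p - 1) / (q - 1); set C := X `^ _ * _.
have qgt0 : 0 < q by lra.
have t1 : t - 1 = (q - p) / (q - 1) by rewrite /t; field; lra.
have t0 : 0 < t by rewrite /t divr_gt0//; lra.
have dpos u : 0 <= u <= k -> 0 < d + e * u.
  move=> /andP[u0 uk]; have [e_ge0|e_lt0] := leP 0 e.
    by rewrite ltr_pwDl// mulr_ge0.
  by apply: lt_le_trans dk0 _; rewrite lerD2l ler_nM2l.
pose G (u : R) := C * ((1 - 1 / q) * ((u `^ t / t) / X)
   + 1 / q * ((A * (u `^ (p + 1) / (p + 1)) + B * (u `^ (p + 2) / (p + 2))) / Y)).
pose dG (u : R) := C * ((1 - 1 / q) * (u `^ (t - 1) / X)
   + 1 / q * ((u `^ p * (A + B * u)) / Y)).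
have G0 : G 0 = 0.
  by rewrite /G !powR0; [ring|rewrite gt_eqF//; lra..].
have GE : G = (C * (1 - 1 / q) / X) *: (fun u : R => u `^ t / t)
   + ((C / q * A / Y) *: (fun u : R => u `^ (p + 1) / (p + 1))
   + (C / q * B / Y) *: (fun u : R => u `^ (p + 2) / (p + 2))).
  by apply/funext => u; rewrite /G !fctE /GRing.scale /=; ring.
rewrite -/(G k).
suff : `|ratio_prim d e k - ratio_prim d e 0| <= G k - G 0.
  by rewrite G0 subr0.
apply: (@ler_norm_increment R (ratio_prim d e) G (fun u => u / (d + e * u)) dG).
- exact: k0.
- move=> u /andP[u0 uk]; apply: is_derive_ratio_prim => //.
  by apply: dpos; rewrite uk ltW.
- move=> u /andP[u0 uk].
  have D1 := is_derive_powR_prim t0 u0.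
  have D2 : is_derive u 1 (fun u : R => u `^ (p + 1) / (p + 1)) (u `^ p).
    by have := @is_derive_powR_prim R (p + 1) u _ u0; rewrite addrK; apply; lra.
  have D3 : is_derive u 1 (fun u : R => u `^ (p + 2) / (p + 2)) (u `^ p * u).
    have := @is_derive_powR_prim R (p + 2) u _ u0.
    rewrite (_ : p + 2 - 1 = p + 1); last by ring.
    by rewrite powRD ?powRr1 ?(ltW u0) ?(gt_eqF u0) ?implybT//; apply; lra.
  have D := is_deriveD (is_deriveZ (C * (1 - 1 / q) / X) D1)
    (is_deriveD (is_deriveZ (C / q * A / Y) D2) (is_deriveZ (C / q * B / Y) D3)).
  rewrite GE; apply: (is_derive_eq D).
  by rewrite /dG /GRing.scale /=; ring.
- have /derivable1_diffP/differentiable_continuous c0 :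
      derivable (ratio_prim d e) 0 1.
    have := @is_derive_ratio_prim R d e 0 e0; rewrite mulr0 addr0 => /(_ d0).
    by case.
  by apply: cvg_at_right_filter; exact: c0.
- have C0 r : 0 < r -> x `^ r / r @[x --> 0^'+] --> (0 : R) `^ r / r.
    by move=> r0; apply: cvgMr_tmp; rewrite powR0 ?gt_eqF//; exact: powR_cvg0.
  by rewrite GE; apply: cvgD; [|apply: cvgD]; apply: cvgZl_tmp; apply: C0; lra.
move=> u /andP[u0 uk].
have duk : 0 < d + e * u by apply: dpos; rewrite uk ltW.
rewrite ger0_norm ?(ltW (divr_gt0 u0 duk))//.
(* the splitting of the weight [u] between the two Hoelder factors *)
have -> : u / (d + e * u) =
    (u `^ (t - 1)) `^ (1 - 1 / q) * (u `^ p * (d + e * u) `^ (- q)) `^ (1 / q).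
  rewrite powRM ?powR_ge0// mulrA -!powRrM -powRD ?(gt_eqF u0) ?implybT//.
  rewrite (_ : (t - 1) * _ + _ = 1) ?powRr1 ?(ltW u0)//; last first.
    by rewrite t1; field; lra.
  by rewrite mulNr div1r mulfV ?gt_eqF// powR_inv1 1?ltW.
apply: le_trans (@weighted_AM_GM_normalized R (1 / q) _ _ X Y _ _ _ X0 Y0) _.
- by rewrite divr_gt0//= ltr_pdivrMr//; lra.
- exact: powR_ge0.
- by rewrite mulr_ge0 ?powR_ge0.
rewrite /dG ler_wpM2l ?mulr_ge0 ?powR_ge0// lerD2l.
rewrite ler_wpM2l ?(divr_ge0 _ (ltW qgt0))// ler_wpM2r ?invr_ge0 ?(ltW Y0)//.
by rewrite ler_wpM2l ?powR_ge0// conv// uk ltW.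
Qed.

(** * The bound on one half of the interval *)

(** [far_moment p m L / (2 * m * (p + 1) * (p + 2))] is the integral over
    [[0, m]] of [`|t - (m - L)| `^ p * ((m - t) / (2 * m))], the weight carried
    by the endpoint [x] of the other half. *)
Definition far_moment (R : realType) (p m L : R) : R :=
  L `^ (p + 2) + (m * p + m + L) * (m - L) `^ (p + 1).

(** [near_moment p m L / (2 * m * (p + 1) * (p + 2))] is the same integral with
    [(m + t) / (2 * m)] in place of [(m - t) / (2 * m)], the weight carried by
    the endpoint [y] of the half under consideration. *)
Definition near_moment (R : realType) (p m L : R) : R :=
  (m * p + 3 * m - L) * (m - L) `^ (p + 1)
  + (2 * m * p + 4 * m - L) * L `^ (p + 1).

Lemma far_moment_gt0 (R : realType) (p m L : R) :
  0 < p -> 0 < m -> 0 <= L <= m -> 0 < far_moment p m L.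
Proof.
move=> p0 m0 /andP[L0 Lm].
have c0 : 0 < m * p + m + L by rewrite ltr_wpDr// addr_gt0// mulr_gt0.
move: L0; rewrite le_eqVlt => /predU1P[<-|L0].
  by rewrite /far_moment ltr_wpDl ?powR_ge0// mulr_gt0 ?powR_gt0//; nra.
by rewrite ltr_wpDr ?mulr_ge0 ?powR_ge0 ?powR_gt0// ltW.
Qed.

Lemma near_moment_ge0 (R : realType) (p m L : R) :
  0 < p -> 0 < m -> 0 <= L <= m -> 0 <= near_moment p m L.
Proof.
by move=> p0 m0 /andP[L0 Lm]; rewrite addr_ge0 ?mulr_ge0 ?powR_ge0//; nra.
Qed.

Lemma powRD1 (R : realType) (x r : R) :
  0 <= x -> r + 1 != 0 -> x `^ (r + 1) = x `^ r * x.
Proof. by move=> x0 r0; rewrite powRD ?powRr1// (negbTE r0). Qed.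

(** The left-hand side is [`|J x y|], the integral of
    [(t - (m - L)) / (amean x y + e * t)] over [[0, m]] with
    [e = (y - x) / (2 * m)].  Cutting at [t = m - L] and measuring the distance
    [u] to that point on both sides gives two integrals of [u / (d + e * u)] and
    [u / (d - e * u)]; their bounds share the constants [X] and [Y], which are
    chosen so that the Hoelder terms of the two sides add up to 1. *)
Lemma hoelder_half_interval (R : realType) (p q m L x y : R) :
  1 < q -> 0 < p <= q -> 0 < m -> 0 <= L <= m ->
  0 < x -> 0 < y -> x != y ->
  `|(L * ln y + (m - L) * ln (amean x y)) / ((y - x) / (2 * m))
    - ((y * ln y - y) - (amean x y * ln (amean x y) - amean x y))
      / ((y - x) / (2 * m)) ^+ 2| <=
  (((m - L) `^ ((2 * q - p - 1) / (q - 1)) + L `^ ((2 * q - p - 1) / (q - 1)))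
   / ((2 * q - p - 1) / (q - 1))) `^ (1 - 1 / q)
  * (1 / (2 * m * (p + 1) * (p + 2))
     * (far_moment p m L / x `^ q + near_moment p m L / y `^ q)) `^ (1 / q).
Proof.
move=> q1 /[dup] pq' /andP[p0 pq] m0 /[dup] Lm' /andP[L0 Lm] x0 y0 xy.
set t := (2 * q - p - 1) / (q - 1); set e := (y - x) / (2 * m).
set c := amean x y.
set X := ((m - L) `^ t + L `^ t) / t; set Y := 1 / _ * _.
(* the point of the half-interval where the weight vanishes *)
pose d := c + e * (m - L).
have m_neq0 : m != 0 by rewrite gt_eqF.
have e0 : e != 0 by rewrite /e mulf_neq0 ?invr_neq0 ?subr_eq0 1?eq_sym//; lra.
have c0 : 0 < c by rewrite /c /amean; lra.
have dL : d + e * L = y by rewrite /d /c /e /amean; field.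
have dM : d + - e * (m - L) = c by rewrite /d; ring.
have dE : d = (L / (2 * m)) * x + (1 - L / (2 * m)) * y.
  by rewrite /d /c /e /amean; field.
have d0 : 0 < d.
  rewrite dE; apply: ltr_wpDl.
    by rewrite !mulr_ge0 ?invr_ge0//; lra.
  by rewrite mulr_gt0// subr_gt0 ltr_pdivrMr//; lra.
have t0 : 0 < t by rewrite /t divr_gt0//; lra.
have X0 : 0 < X.
  rewrite /X divr_gt0//; have [->|Ln0] := eqVneq L 0.
    by rewrite ltr_wpDr ?powR_ge0 ?powR_gt0//; lra.
  by rewrite ltr_wpDl ?powR_ge0 ?powR_gt0 ?lt0r ?Ln0.
have Y0 : 0 < Y.
  rewrite /Y mulr_gt0//; first by rewrite divr_gt0// !mulr_gt0//; lra.
  rewrite ltr_wpDr ?divr_ge0 ?powR_ge0 ?near_moment_ge0//.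
  by rewrite divr_gt0 ?powR_gt0 ?far_moment_gt0.
have conv w : 0 <= w <= 2 * m ->
    (w / (2 * m) * x + (1 - w / (2 * m)) * y) `^ (- q)
    <= w / (2 * m) * x `^ (- q) + (1 - w / (2 * m)) * y `^ (- q).
  move=> /andP[w0 wm]; apply: convex_powRN => //; first lra.
  by rewrite divr_ge0 ?ler_pdivrMr ?mul1r//; lra.
(* At distance [u] from [d], the weight of [x] in the convexity bound is
   [(L - u) / (2 * m)] towards [y] and [(L + u) / (2 * m)] towards [c]. *)
pose A := L / (2 * m) * x `^ (- q) + (1 - L / (2 * m)) * y `^ (- q).
pose B := (y `^ (- q) - x `^ (- q)) / (2 * m).
have right : `|ratio_prim d e L - ratio_prim d e 0| <= _ :=
  @hoelder_ratio_prim R p q d e L A B X Y q1 pq' L0 e0 d0 _ X0 Y0 _.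
have left : `|ratio_prim d (- e) (m - L) - ratio_prim d (- e) 0| <= _ :=
  @hoelder_ratio_prim R p q d (- e) (m - L) A (- B) X Y q1 pq' _ _ d0 _ X0 Y0 _.
have -> : (L * ln y + (m - L) * ln c) / e
    - ((y * ln y - y) - (c * ln c - c)) / e ^+ 2
    = (ratio_prim d e L - ratio_prim d e 0)
      - (ratio_prim d (- e) (m - L) - ratio_prim d (- e) 0).
  rewrite /ratio_prim dL dM !mulr0 !addr0 !mul0r; field.
  by rewrite ?e0.
apply: le_trans (ler_normB _ _) _.
apply: le_trans (lerD (right _ _) (left _ _ _ _)) _.
- by rewrite dL.
- move=> u /andP[u0 uL].
  rewrite (_ : d + e * u = (L - u) / (2 * m) * x + (1 - (L - u) / (2 * m)) * y).
    apply: le_trans (conv _ _) _; first by apply/andP; split; lra.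
    by rewrite /A /B le_eqVlt; apply/orP; left; apply/eqP; field.
  by rewrite dE /e; field.
- by rewrite subr_ge0.
- by rewrite oppr_eq0.
- by rewrite dM.
- move=> u /andP[u0 uL].
  rewrite (_ : d + - e * u = (L + u) / (2 * m) * x + (1 - (L + u) / (2 * m)) * y).
    apply: le_trans (conv _ _) _; first by apply/andP; split; lra.
    by rewrite /A /B le_eqVlt; apply/orP; left; apply/eqP; field.
  by rewrite dE /e; field.
rewrite -/t -mulrDr.
have XE : L `^ t / t + (m - L) `^ t / t = X by rewrite /X; ring.
have YE : (A * (L `^ (p + 1) / (p + 1)) + B * (L `^ (p + 2) / (p + 2)))
    + (A * ((m - L) `^ (p + 1) / (p + 1)) - B * ((m - L) `^ (p + 2) / (p + 2)))
    = Y.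
  rewrite /A /B /Y /far_moment /near_moment !powRN.
  have -> : p + 2 = (p + 1) + 1 by ring.
  rewrite !(@powRD1 _ _ (p + 1)) ?subr_ge0//; try by rewrite gt_eqF//; lra.
  field.
  by rewrite !gt_eqF ?powR_gt0//; lra.
rewrite le_eqVlt; apply/orP; left; apply/eqP.
rewrite -[RHS]mulr1; congr (_ * _).
transitivity ((1 - 1 / q) * ((L `^ t / t + (m - L) `^ t / t) / X)
  + 1 / q * ((A * (L `^ (p + 1) / (p + 1)) + B * (L `^ (p + 2) / (p + 2))
    + (A * ((m - L) `^ (p + 1) / (p + 1))
       - B * ((m - L) `^ (p + 2) / (p + 2)))) / Y)); first ring.
by rewrite XE YE !divff ?gt_eqF//; ring.
Qed.

(** * Logarithms of the means and conclusion *)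

Lemma ln_imean (R : realType) (a b : R) : 0 < a -> a < b ->
  ln (imean a b) = (b * ln b - a * ln a) / (b - a) - 1.
Proof.
move=> a0 ab; have b0 : 0 < b by lra.
rewrite /imean lt_eqF// lnM ?posrE ?divr_gt0 ?powR_gt0 ?divr_gt0 ?powR_gt0//.
rewrite ?expR_gt0// ln_div ?posrE ?expR_gt0// ln1 expRK ln_powR.
rewrite ln_div ?posrE ?powR_gt0// !ln_powR; ring.
Qed.

Lemma ln_gmean (R : realType) (a b : R) : 0 < a -> 0 < b ->
  ln (gmean a b) = (ln a + ln b) / 2.
Proof.
move=> a0 b0; rewrite /gmean -powR12_sqrt ?mulr_ge0 ?ltW//.
by rewrite ln_powR lnM ?posrE// mulrC.
Qed.

Theorem theorem4p3 (R : realType) (a b p q m l : R)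
    (ha : 0 < a) (hab : a < b)
    (hq : 1 < q) (hp : 0 < p) (hpq : p <= q)
    (hm : 0 < m) (hl : 0 <= 2 * l) (hlm : 2 * l <= m) :
  `| (2 * l * ln (gmean a b)
      + (m - 2 * l) * ln (amean a b)) / m
     - ln (imean a b) |
  <= (b - a) / (4 * m ^+ 2)
     * ((q - 1) / (2 * q - p - 1)) `^ (1 - 1 / q)
     * (1 / (2 * m * (p + 1) * (p + 2))) `^ (1 / q)
     * ((m - 2 * l) `^ ((2 * q - p - 1) / (q - 1))
        + (2 * l) `^ ((2 * q - p - 1) / (q - 1))) `^ (1 - 1 / q)
     * ((((2 * l) `^ (p + 2)
           + (m * p + m + 2 * l) * (m - 2 * l) `^ (p + 1)) / a `^ q
         + ((m * p + 3 * m - 2 * l) * (m - 2 * l) `^ (p + 1)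
           + (2 * m * p + 4 * m - 2 * l) * (2 * l) `^ (p + 1)) / b `^ q)
          `^ (1 / q)
        + (((2 * m * p + 4 * m - 2 * l) * (2 * l) `^ (p + 1)
           + (m * p + 3 * m - 2 * l) * (m - 2 * l) `^ (p + 1)) / a `^ q
         + ((2 * l) `^ (p + 2)
           + (m * p + m + 2 * l) * (m - 2 * l) `^ (p + 1)) / b `^ q)
          `^ (1 / q)).
Proof.
have L01 : 0 <= 2 * l <= m by rewrite hl.
have pq' : 0 < p <= q by rewrite hp.
have b0 : 0 < b by lra.
have ab_neq : a != b by rewrite lt_eqF.
have ba_neq : b != a by rewrite eq_sym.
have := hoelder_half_interval hq pq' hm L01 ha b0 ab_neq.
have := hoelder_half_interval hq pq' hm L01 b0 ha ba_neq.
rewrite /amean (addrC b a).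
have t0 : 0 < (2 * q - p - 1) / (q - 1) by rewrite divr_gt0//; lra.
set J2 := (X in `|X| <= _ -> _); set c := (a + b) / 2 in J2 *.
move=> J2le; set J1 := (X in `|X| <= _ -> _) => J1le.
(* The values of [c * ln c - c] coming from the two halves cancel. *)
have -> : (2 * l * ln (gmean a b) + (m - 2 * l) * ln (amean a b)) / m
     - ln (imean a b) = (b - a) / (4 * m ^+ 2) * (J1 - J2).
  rewrite ln_imean// ln_gmean// -/c /J1 /J2; field.
  by rewrite !subr_eq0 ba_neq ab_neq gt_eqF.
have k0 : 0 <= (b - a) / (4 * m ^+ 2).
  by rewrite divr_ge0 ?mulr_ge0 ?exprn_ge0 ?subr_ge0// ltW.
have mulrA5 (u v w y z : R) : u * v * w * y * z = u * (v * w * y * z) by ring.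
rewrite mulrA5 normrM (ger0_norm k0) ler_wpM2l//.
apply: le_trans (ler_normB _ _) _.
apply: le_trans (lerD J1le J2le) _.
clear J1le J2le; clearbody J1 J2 c.
have -> : (q - 1) / (2 * q - p - 1) = ((2 * q - p - 1) / (q - 1))^-1.
  by rewrite invf_div.
have moments_ge0 (x y : R) : 0 < x -> 0 < y ->
    0 <= far_moment p m (2 * l) / x `^ q + near_moment p m (2 * l) / y `^ q.
  move=> x0 y0; rewrite addr_ge0// divr_ge0 ?powR_ge0 ?near_moment_ge0//.
  by rewrite ltW ?far_moment_gt0.
have p10 : 0 < p + 1 by lra.
have p20 : 0 < p + 2 by lra.
have K0 : 0 <= 1 / (2 * m * (p + 1) * (p + 2)).
  by rewrite ltW// divr_gt0// !mulr_gt0.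
have tV0 : 0 <= ((2 * q - p - 1) / (q - 1))^-1 by rewrite invr_ge0 ltW.
have S0 : 0 <= (m - 2 * l) `^ ((2 * q - p - 1) / (q - 1))
             + (2 * l) `^ ((2 * q - p - 1) / (q - 1)).
  by rewrite addr_ge0 ?powR_ge0.
rewrite (powRM _ S0 tV0) (powRM _ K0 (moments_ge0 _ _ ha b0)).
rewrite (powRM _ K0 (moments_ge0 _ _ b0 ha)).
have factor (u v w y z : R) :
    u * v * (w * y) + u * v * (w * z) = v * w * u * (y + z) by ring.
(* The bracket of the second half lists its terms in the opposite order. *)
have nearC : near_moment p m (2 * l) =
    (2 * m * p + 4 * m - 2 * l) * (2 * l) `^ (p + 1)
    + (m * p + 3 * m - 2 * l) * (m - 2 * l) `^ (p + 1).
  by rewrite /near_moment addrC.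
rewrite factor [far_moment p m (2 * l) / b `^ q + _]addrC {2}nearC.
by rewrite /far_moment /near_moment.
Qed.
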